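(* Let $N$ be a positive integer and let $z=(z_1,\dots,z_{2N})$ be fixed distinct complex numbers. Consider the polynomial in the variables $y=(y_1,\dots,y_{2N})$ $$P(y;z)=\det_{1\le a,b\le N}\left(\frac{y_a-y_{N+b}}{z_a-z_{N+b}}\right)=\sum_{\sigma\in S_N}(-1)^\sigma\prod_{a=1}^N\frac{y_{\sigma_a}-y_{N+a}}{z_{\sigma_a}-z_{N+a}} .$$ Then $P(y;z)$, as a polynomial in $y$, is $\mathfrak{sl}_2$-invariant, is homogeneous of degree $N$, has degree not greater than one with respect to each variable $y_1,\dots,y_{2N}$, and has order $N-1$ at $y=z$ (order of vanishing). Therefore this polynomial is a generator of the space $W(z)\subset (V_1)^{\otimes 2N}$ of conformal blocks at level one.
   Context: $\mathfrak{sl}_2$ is the complex Lie algebra with generators $e,f,h$ and relations $[e,f]=h$, $[h,e]=2e$, $[h,f]=-2f$; $V_1$ is its irreducible module with highest weight $1$. The tensor product $(V_1)^{\otimes 2N}$ is realized as the vector space of polynomials $p(y_1,\dots,y_{2N})$ with complex coefficients of degree not greater than one with respect to each variable, with the standard $\mathfrak{sl}_2$-action in which each factor $V_1$ is the space of polynomials of degree at most one in $y_a$ and $$e\mapsto \sum_{a=1}^{2N}\partial_{y_a},\qquad h\mapsto \sum_{a=1}^{2N}(1-2y_a\partial_{y_a}),\qquad f\mapsto\sum_{a=1}^{2N}(y_a-y_a^2\partial_{y_a}).$$ $\mathfrak{sl}_2$-invariant means annihilated by $e,f,h$. Let $e_a=\partial_{y_a}$ be the operator acting as $e$ on the $a$-th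 tensor factor and as the identity on the others. The space of conformal blocks at level one is $$W(z)=\Big\{v\in (V_1)^{\otimes 2N}\ \Big|\ hv=0,\ ev=0,\ \Big(\sum_{a=1}^{2N}z_ae_a\Big)^2v=0\Big\}.$$ It is a one-dimensional space; ''generator'' means a nonzero element spanning it. $S_N$ is the symmetric group and $(-1)^\sigma$ the sign of $\sigma$. *)

(* Defs.v *)
From HB Require Import structures.
From mathcomp Require Import all_boot all_order all_algebra all_fingroup.
From mathcomp Require Import reals complex.
From mathcomp Require Import mpoly.

Set Implicit Arguments.
Unset Strict Implicit.
Unset Printing Implicit Defensive.

Import GRing.Theory.
Local Open Scope ring_scope.

(* 'X_i is the variable y_(i+1).  The generators of sl_2 act on all of
   {mpoly K[n]}; (V_1)^{\otimes n} is the stable subspace [tensorV1]. *)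
Section SL2.
Variables (K : comNzRingType) (n : nat).
Implicit Types (p v w : {mpoly K[n]}) (z : 'I_n -> K).

Definition mdegvar (i : 'I_n) p : nat := \max_(m <- msupp p) m i.

Definition tensorV1 p : Prop := forall i : 'I_n, (mdegvar i p <= 1)%N.

Definition opE p : {mpoly K[n]} := \sum_(a < n) p^`M(a).

Definition opH p : {mpoly K[n]} := \sum_(a < n) (p - 2%:R *: ('X_a * p^`M(a))).

Definition opF p : {mpoly K[n]} :=
  \sum_(a < n) ('X_a * p - 'X_a ^+ 2 * p^`M(a)).

Definition sl2_invariant p : Prop := [/\ opE p = 0, opF p = 0 & opH p = 0].

Definition opEz z p : {mpoly K[n]} := \sum_(a < n) z a *: p^`M(a).

Definition conformal_block z v : Prop :=
  [/\ tensorV1 v, opH v = 0, opE v = 0 & opEz z (opEz z v) = 0].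

Definition generator (W : {mpoly K[n]} -> Prop) v : Prop :=
  v <> 0 /\ forall w, W w <-> exists c : K, w = c *: v.

(* The order of the zero of p at x is exactly k (meant for characteristic 0). *)
Definition vanishing_order p (x : 'I_n -> K) (k : nat) : Prop :=
  (forall m : 'X_{1..n}, (mdeg m < k)%N -> (p^`M[m]).@[x] = 0) /\
  (exists2 m : 'X_{1..n}, mdeg m = k & (p^`M[m]).@[x] <> 0).

End SL2.

Section DetPolynomial.
Variables (K : fieldType) (N : nat).

(* For a, b : 'I_N, lshift N a indexes the first N variables (y_a) and
   rshift N b the last N (y_(N+b)). *)
Definition entryP (z : 'I_(N + N) -> K) (a b : 'I_N) : {mpoly K[N + N]} :=
  (z (lshift N a) - z (rshift N b))^-1 *: ('X_(lshift N a) - 'X_(rshift N b)).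

Definition detP (z : 'I_(N + N) -> K) : {mpoly K[N + N]} :=
  \det (\matrix_(a < N, b < N) entryP z a b).

End DetPolynomial.

(* Main.v *)
From HB Require Import structures.
Require Import Defs.
From mathcomp Require Import all_boot all_order all_algebra all_fingroup.
From mathcomp Require Import reals complex.
From mathcomp Require Import mpoly.

Set Implicit Arguments.
Unset Strict Implicit.
Unset Printing Implicit Defensive.

Import GRing.Theory Num.Theory.
Local Open Scope ring_scope.

(** Write D_w = \sum_a w_a \partial_a. Each product in the expansion of the
    determinant P is killed by e, f and h. Subtracting one row from the others
    leaves a single row not killed by D_z, so D_z^2 P = 0 and P lies in W(z).

    Uniqueness: let v in W(z), with coefficients c_S, #|S| = N. By translation
    invariance and D_z^2 v = 0, v vanishes at every point equal to z - t except
    at no more than N - 2 places, where it is 0; by translation invariance it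
    also vanishes at indicators of sets of size N + 1. Expanding at
    such points supported on a set A of size N + 1 gives, for k in A and
    d_k = c_(A \ k), the relations \sum d_k = 0 and \sum d_k / (z_k - z_j) = 0
    for the N - 1 indices j outside A. They form a nonsingular bordered Cauchy
    system on any N of the d_k, so one zero coefficient c_S propagates from S to
    all sets obtained by exchanging one element, hence to all sets.

    Vanishing order: for q homogeneous of degree d, (D_z q)(z) = d q(z). Applied
    to the derivatives q of v in W(z), D_z^2 v = 0 gives q(z) = 0 for d > 1,
    while for d = 1 the values q(z) are the coefficients of D_z v up to
    factorials; and D_z v <> 0, since D_z v = 0 would force v = 0 in the same
    way as above. *)

(** * Degree in one variable, and homogeneity of products *)

Section DegreeInOneVariable.
Variables (K : comNzRingType) (n : nat).
Implicit Types (p q : {mpoly K[n]}) (i : 'I_n).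

Lemma mdegvar_leP i k p :
  reflect (forall m, p@_m != 0 -> (m i <= k)%N) (mdegvar i p <= k)%N.
Proof.
apply: (iffP idP) => [le_pk m|le_pk].
  rewrite -mcoeff_msupp => mp; apply: leq_trans le_pk.
  exact: leq_bigmax_seq.
rewrite /mdegvar big_seq; elim/big_ind: _ => // [a b|m].
  by rewrite geq_max => -> ->.
by rewrite mcoeff_msupp => /le_pk.
Qed.

Lemma mdegvarD i k p q :
  (mdegvar i p <= k)%N -> (mdegvar i q <= k)%N -> (mdegvar i (p + q) <= k)%N.
Proof.
move=> /mdegvar_leP lep /mdegvar_leP leq; apply/mdegvar_leP => m.
rewrite mcoeffD; have [->|/lep //] := eqVneq p@_m 0.
by rewrite add0r => /leq.
Qed.

Lemma mdegvarZ i k c p : (mdegvar i p <= k)%N -> (mdegvar i (c *: p) <= k)%N.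
Proof.
move=> /mdegvar_leP lep; apply/mdegvar_leP => m; rewrite mcoeffZ => nz.
by apply: lep; apply: contraNneq nz => ->; rewrite mulr0.
Qed.

Lemma mdegvarX i j : (mdegvar i ('X_j : {mpoly K[n]}) <= (j == i))%N.
Proof.
apply/mdegvar_leP => m; rewrite mcoeffX.
have [<- _|_] := eqVneq U_(j)%MM m; last by rewrite eqxx.
by rewrite mnm1E.
Qed.

Lemma mdegvarM i k l p q : (mdegvar i p <= k)%N -> (mdegvar i q <= l)%N ->
  (mdegvar i (p * q) <= k + l)%N.
Proof.
move=> /mdegvar_leP lep /mdegvar_leP leq; apply/mdegvar_leP => m.
rewrite -mcoeff_msupp => /msuppM_le /allpairsP [[m1 m2] /= []].
rewrite !mcoeff_msupp => /lep le1 /leq le2 ->.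
by rewrite mnmDE leq_add.
Qed.

Lemma mdegvar_prod (I : finType) (F : I -> {mpoly K[n]}) i (d : I -> nat) :
  (forall a, (mdegvar i (F a) <= d a)%N) ->
  (mdegvar i (\prod_a F a) <= \sum_a d a)%N.
Proof.
move=> leF; elim/big_ind2: _ => //= [|p k q l]; last exact: mdegvarM.
apply/mdegvar_leP => m; rewrite mcoeff1.
by have [->|_] := eqVneq m 0%MM; rewrite ?mnm0E ?eqxx.
Qed.

Lemma dhomog_prod_const (I : finType) (F : I -> {mpoly K[n]}) :
  (forall a, F a \is 1.-homog) -> \prod_a F a \is #|I|.-homog.
Proof.
move=> homF; rewrite -sum1_card.
elim/big_ind2: _ => //= [|p k q l]; [exact: dhomog1|exact: dhomogM].
Qed.

End DegreeInOneVariable.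

(** * First-order differential operators and Euler's identity *)

Section VectorFields.
Variables (K : comNzRingType) (n : nat).
Implicit Types (p q : {mpoly K[n]}) (f : 'I_n -> {mpoly K[n]}) (w : 'I_n -> K).

(** The operators [opE] and [opEz], the Euler field in [opH] and the quadratic field in [opF] all
    have this form, so one Leibniz rule serves them all. *)
Definition vfield f p : {mpoly K[n]} := \sum_(a < n) f a * p^`M(a).

Lemma opEzE w p : opEz w p = vfield (fun a => (w a)%:MP) p.
Proof. by apply: eq_bigr => a _; rewrite mul_mpolyC. Qed.

Lemma opE_opEz p : opE p = opEz (fun=> 1) p.
Proof. by apply: eq_bigr => a _; rewrite scale1r. Qed.

Lemma vfield_is_linear f : linear (vfield f).
Proof.
move=> c p q; rewrite /vfield scaler_sumr -big_split /=.
by apply: eq_bigr => a _; rewrite mderivD mderivZ mulrDr scalerAr.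
Qed.

HB.instance Definition _ f := GRing.isLinear.Build K {mpoly K[n]} {mpoly K[n]}
  *:%R (vfield f) (vfield_is_linear f).

Lemma opEz_is_linear w : linear (opEz w).
Proof. by move=> c p q; rewrite !opEzE linearP. Qed.

HB.instance Definition _ w := GRing.isLinear.Build K {mpoly K[n]} {mpoly K[n]}
  *:%R (opEz w) (opEz_is_linear w).

Lemma vfieldM f p q : vfield f (p * q) = vfield f p * q + p * vfield f q.
Proof.
rewrite /vfield mulr_suml mulr_sumr -big_split /=.
by apply: eq_bigr => a _; rewrite mderivM mulrDr !mulrA (mulrC p).
Qed.

Lemma vfield1 f : vfield f 1 = 0.
Proof. by rewrite /vfield big1 // => a _; rewrite -mpolyC1 mderivC mulr0. Qed.

Lemma vfieldXU f i : vfield f 'X_i = f i.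
Proof.
rewrite /vfield (bigD1 i) //= big1 => [|a /negPf ne_ai].
  rewrite mderivX mnm1E eqxx scale1r addr0.
  have -> : (U_(i) - U_(i))%MM = 0%MM :> 'X_{1..n}.
    by apply/mnmP => j; rewrite mnmBE subnn mnm0E.
  by rewrite mpolyX0 mulr1.
by rewrite mderivX mnm1E eq_sym ne_ai scale0r mulr0.
Qed.

Lemma opEzXU w i : opEz w 'X_i = (w i)%:MP.
Proof. by rewrite opEzE vfieldXU. Qed.

(** Logarithmic derivatives add. For e the [G a] are 0; for f they are sums of two variables. *)
Lemma vfield_prod (I : finType) f (F G : I -> {mpoly K[n]}) :
  (forall a, vfield f (F a) = G a * F a) ->
  vfield f (\prod_a F a) = (\sum_a G a) * \prod_a F a.
Proof.
move=> eqF; elim/big_rec2: _ => [|a s p _ IH]; first by rewrite vfield1 mul0r.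
by rewrite vfieldM eqF IH mulrDl !mulrA [F a * s]mulrC.
Qed.

Lemma vfield_sum (I : Type) (r : seq I) (P : pred I) f (F : I -> {mpoly K[n]}) :
  vfield f (\sum_(i <- r | P i) F i) = \sum_(i <- r | P i) vfield f (F i).
Proof. exact: linear_sum. Qed.

Lemma vfield_det0 f k (A : 'M[{mpoly K[n]}]_k) :
  (forall i j, vfield f (A i j) = 0) -> vfield f (\det A) = 0.
Proof.
move=> eqA; rewrite /determinant vfield_sum big1 // => s _.
have prodK : vfield f (\prod_i A i (s i)) = 0.
  rewrite (vfield_prod (G := fun=> 0)) => [|a]; last by rewrite mul0r eqA.
  by rewrite big1 ?mul0r.
have signK : vfield f ((-1) ^+ s) = 0.
  by case: (odd_perm s); rewrite ?expr1 ?expr0 ?linearN /= vfield1 ?oppr0.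
by rewrite vfieldM signK prodK mul0r mulr0 addr0.
Qed.

Lemma opEz_mderiv w p a : opEz w p^`M(a) = (opEz w p)^`M(a).
Proof.
rewrite /opEz linear_sum; apply: eq_bigr => b _ /=.
by rewrite mderivZ mderiv_comm.
Qed.

Lemma opEz_mderivm w p m : opEz w p^`M[m] = (opEz w p)^`M[m].
Proof.
rewrite /opEz linear_sum; apply: eq_bigr => b _ /=.
by rewrite mderivmZ -!mderivmU1m -!mderivmDm addmC.
Qed.

Lemma opEz_comm w w' p : opEz w (opEz w' p) = opEz w' (opEz w p).
Proof.
rewrite {2}/opEz linear_sum; apply: eq_bigr => b _ /=.
by rewrite linearZ /= opEz_mderiv.
Qed.

Lemma opEz_sub_const w c p :
  opEz (fun a => w a - c) p = opEz w p - c *: opE p.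
Proof.
rewrite opE_opEz [opEz (fun=> 1) p]/opEz scaler_sumr -sumrB.
by apply: eq_bigr => a _; rewrite scale1r scalerBl.
Qed.

Lemma mcoeff_euler p m : (vfield (fun a => 'X_a) p)@_m = p@_m *+ mdeg m.
Proof.
have eulerX (k : 'X_{1..n}) :
    vfield (fun a => 'X_a) 'X_[k] = 'X_[k] *+ mdeg k.
  rewrite mdegE -sumrMnr; apply: eq_bigr => a _.
  rewrite mderivX scaler_nat mulrnAr -mpolyXD.
  (* For [k a = 0] the truncated exponent is not a true difference, but its coefficient is 0. *)
  have [-> //|ka] := posnP (k a).
  rewrite addmC submK //; apply/mnm_lepP => b.
  by rewrite mnm1E; case: eqP => // <-.
have -> : p@_m = \sum_(k <- msupp p) p@_k * (k == m)%:R.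
  by rewrite {1}(mpolyE p) raddf_sum; apply: eq_bigr => k _ /=; rewrite mcoeffZ mcoeffX.
rewrite {1}(mpolyE p) vfield_sum raddf_sum -sumrMnl; apply: eq_bigr => k _ /=.
rewrite linearZ /= eulerX mcoeffZ mcoeffMn mcoeffX.
by have [->|_] := eqVneq k m; rewrite !mulrnAr // !mulr0n !mul0rn.
Qed.

Lemma euler_homog d p : p \is d.-homog -> vfield (fun a => 'X_a) p = p *+ d.
Proof.
move=> homp; apply/mpolyP => m; rewrite mcoeff_euler mcoeffMn.
have [<- //|ne] := eqVneq (mdeg m) d.
by rewrite (dhomog_nemf_coeff homp ne) !mul0rn.
Qed.

(** At the point [w] itself, the constant field [w] coincides with the Euler field. *)
Lemma meval_opEz_homog d p w : p \is d.-homog -> (opEz w p).@[w] = p.@[w] *+ d.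
Proof.
move=> homp; rewrite -mevalMn -euler_homog // raddf_sum [RHS]raddf_sum.
by apply: eq_bigr => a _ /=; rewrite mevalZ mevalM mevalXU.
Qed.

Lemma opHE p : opH p = p *+ n - (vfield (fun a => 'X_a) p) *+ 2.
Proof.
rewrite /opH sumrB sumr_const card_ord; congr (_ - _).
by rewrite -scaler_sumr scaler_nat.
Qed.

Lemma opH_is_linear : linear (@opH K n).
Proof.
move=> c p q; rewrite !opHE linearP /= scalerBr -!scalerMnr !mulrnDl opprD.
exact: addrACA.
Qed.

HB.instance Definition _ := GRing.isLinear.Build K {mpoly K[n]} {mpoly K[n]}
  *:%R (@opH K n) opH_is_linear.

Lemma opFE p : opF p = (\sum_(a < n) 'X_a) * p - vfield (fun a => 'X_a ^+ 2) p.
Proof. by rewrite /opF sumrB mulr_suml. Qed.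

Lemma dhomog_opEz d p w : p \is d.-homog -> opEz w p \is d.-1.-homog.
Proof.
move=> homp; apply: rpred_sum => a _; apply: dhomogZ; apply/dhomogP => m.
rewrite mcoeff_msupp mcoeff_mderiv => nz.
rewrite -(dhomog_mf homp (_ : (m + U_(a))%MM \in _)); last first.
  by rewrite mcoeff_msupp; apply: contraNneq nz => ->; rewrite mul0rn.
by rewrite /= mdegD mdeg1 addn1.
Qed.

Lemma dhomog_mderivm d p m : p \is d.-homog -> p^`M[m] \is (d - mdeg m).-homog.
Proof.
move=> homp; apply/dhomogP => k; rewrite mcoeff_msupp mcoeff_mderivm => nz.
rewrite -(dhomog_mf homp (_ : (m + k)%MM \in _)); last first.
  by rewrite mcoeff_msupp; apply: contraNneq nz => ->; rewrite mul0rn.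
by rewrite /= mdegD addKn.
Qed.

End VectorFields.

(** * A bordered Cauchy system *)

(* The polynomial [p] below is [\prod_(l in S) ('X - z l)] times the function
   [t |-> - \sum_(k in S) d k / (z k - t)]; it vanishes on [s], and its top
   coefficient is [\sum_(k in S) d k]. *)
Lemma cauchy_kernel (K : fieldType) (I : finType) (z d : I -> K)
    (S : {set I}) (s : seq K) :
  injective z -> uniq s -> {in S, forall k, z k \notin s} ->
  (#|S| <= (size s).+1)%N -> \sum_(k in S) d k = 0 ->
  {in s, forall t, \sum_(k in S) d k / (z k - t) = 0} ->
  {in S, forall k, d k = 0}.
Proof.
move=> z_inj uniq_s zNs leSs sum0 sums k0 k0S.
pose q k := \prod_(l in S :\ k) ('X - (z l)%:P).
pose p := \sum_(k in S) d k *: q k.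
have coef_q k i : k \in S -> (#|S|.-1 <= i)%N -> (q k)`_i = (i == #|S|.-1)%:R.
  move=> kS; have sz : size (q k) = #|S|.-1.+1.
    by rewrite /q -big_enum size_prod_XsubC -cardE (cardsD1 k S) kS.
  have mq : q k \is monic by rewrite /q -big_enum monic_prod_XsubC.
  rewrite leq_eqVlt => /orP [/eqP <-|lt_i].
    by rewrite eqxx; move/monicP: mq; rewrite /lead_coef sz.
  by rewrite nth_default ?sz // gtn_eqF.
have szp : (size p <= size s)%N.
  apply/leq_sizeP => i le_i.
  have le_Si : (#|S|.-1 <= i)%N.
    apply: leq_trans le_i; rewrite -ltnS.
    by apply: leq_trans leSs; rewrite (cardsD1 k0 S) k0S.
  transitivity ((\sum_(k in S) d k) * (i == #|S|.-1)%:R); last by rewrite sum0 mul0r.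
  rewrite coef_sum mulr_suml.
  by apply: eq_bigr => k kS; rewrite coefZ coef_q.
have eval_q k x : (q k).[x] = \prod_(l in S :\ k) (x - z l).
  by rewrite horner_prod; apply: eq_bigr => l _; rewrite hornerXsubC.
have p0 : p = 0.
  apply: contraTeq szp => nz_p; rewrite -ltnNge.
  apply: max_poly_roots => //; apply/allP => t ts; apply/eqP.
  transitivity (- \prod_(l in S) (t - z l) * \sum_(k in S) d k / (z k - t)).
    rewrite horner_sum mulr_sumr; apply: eq_bigr => k kS.
    rewrite hornerZ eval_q (big_setD1 k kS) /= mulrCA; congr (_ * _).
    have nz : z k - t != 0.
      by rewrite subr_eq0; apply: contraTneq ts => <-; apply: zNs.
    by rewrite -[t - z k]opprB !mulNr opprK mulrAC mulfV ?mul1r.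
  by rewrite sums // mulr0.
(* At [z k0] only the term of [q k0] survives, and [q k0] is nonzero there. *)
have := congr1 (fun r : {poly K} => r.[z k0]) p0.
rewrite horner0 horner_sum (big_setD1 k0 k0S) /= [X in _ + X]big1 ?addr0.
  rewrite hornerZ eval_q => /eqP; rewrite mulf_eq0 => /orP [/eqP //|].
  rewrite prodf_seq_eq0 => /hasP [l _ /andP []].
  by rewrite in_setD1 => /andP [/negPf ne _]; rewrite subr_eq0 (inj_eq z_inj) eq_sym ne.
move=> k; rewrite in_setD1 => /andP [ne kS].
rewrite hornerZ eval_q (bigD1 k0) /=; last by rewrite in_setD1 eq_sym ne.
by rewrite subrr mul0r mulr0.
Qed.

(** * Restriction to lines, and values of multiaffine polynomials *)

Section Lines.
Variables (K : numFieldType) (n : nat).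
Implicit Types (v p : {mpoly K[n]}) (w : 'I_n -> K).

(** Chain rule along a line of velocity [w]: both sides obey the same Leibniz rule, so the variables
    suffice. *)
Lemma deriv_mmap (h : 'I_n -> {poly K}) w p :
  (forall i, (h i)^`() = (w i)%:P) ->
  (mmap polyC h p)^`() = mmap polyC h (opEz w p).
Proof.
move=> dh; pose P q := (mmap polyC h q)^`() = mmap polyC h (opEz w q).
have P1 : P 1 by rewrite /P opEzE vfield1 rmorph0 rmorph1 derivC.
have PM q r : P q -> P r -> P (q * r).
  by rewrite /P !opEzE vfieldM rmorphM rmorphD !rmorphM derivM => -> ->.
have PX i : P 'X_i by rewrite /P opEzXU mmapX mmap1U dh mmapC.
rewrite -/(P p); elim/mpolyind: p => [|c m p _ _ IH].
  by rewrite /P linear0 rmorph0 deriv0.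
suff PXm : P 'X_[m].
  rewrite /P !opEzE [vfield _ _]linearP /= -!opEzE !mmapD !mmapZ.
  rewrite derivD derivM derivC mul0r add0r.
  by rewrite IH PXm.
rewrite mpolyXE_id; apply: (big_ind P) => // i _.
by elim: (m i) => [//|k]; rewrite exprS; apply: PM.
Qed.

Lemma derivn_mmap (h : 'I_n -> {poly K}) w p k :
  (forall i, (h i)^`() = (w i)%:P) ->
  (mmap polyC h p)^`(k) = mmap polyC h (iter k (opEz w) p).
Proof. by move=> dh; elim: k => [//|k IH]; rewrite derivnS IH (deriv_mmap _ dh). Qed.

(* Along the line joining [- w] on the complement of [S] (at time 0) to the
   evaluation point (at time 1) with direction [w], [v] has degree at most [k],
   and yet is divisible by the power [k.+1] of the time. *)
Lemma meval_restrict_eq0 N k v w (S : {set 'I_n}) :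
  (forall i, (mdegvar i v <= 1)%N) -> v \is N.-homog ->
  iter k.+1 (opEz w) v = 0 -> (#|~: S| + k < N)%N ->
  v.@[fun i => if i \in S then w i else 0] = 0.
Proof.
move=> v1 homv Dv ltN.
pose g i : {poly K} := if i \in S then 'X else 'X - 1%:P.
pose h i := (w i)%:P * g i.
have dh i : (h i)^`() = (w i)%:P.
  rewrite /h /g derivM derivC mul0r add0r.
  by case: ifP => _; rewrite ?derivX ?derivXsubC mulr1.
have : dvdp 'X^(k.+1) (mmap polyC h v).
  rewrite /mmap big_seq; apply: (big_ind (dvdp 'X^(k.+1))) => [|p q|m mv].
  - exact: dvdp0.
  - exact: dvdp_add.
  apply: dvdp_mull; rewrite /mmap1.
  have -> : \prod_i h i ^+ m i = (\prod_i (w i)%:P ^+ m i) * \prod_i g i ^+ m i.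
    by rewrite -big_split; apply: eq_bigr => i _ /=; rewrite exprMn.
  apply: dvdp_mull; rewrite (bigID (mem S)) /=; apply: dvdp_mulr.
  have -> : \prod_(i in S) g i ^+ m i = 'X^(\sum_(i in S) m i).
    by rewrite -prodrXr; apply: eq_bigr => i iS; rewrite /g iS.
  (* Exponents are at most 1, so at most [#|~: S|] of the total degree [N] lies outside [S]; at
     least [k.+1] factors ['X] remain. *)
  apply: dvdp_exp2l; rewrite -ltnS -(ltn_add2l #|~: S|) addnS.
  apply: (leq_trans (n := N.+1)); first by rewrite ltnS.
  rewrite addnS ltnS -(dhomog_mf homv mv) /= mdegE (bigID (mem S)) /= addnC leq_add2r.
  rewrite -sum1_card (eq_bigl (fun i => i \notin S)) => [|i]; last by rewrite inE.
  apply: leq_sum => i _; move/mdegvar_leP: (v1 i); apply.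
  by rewrite -mcoeff_msupp.
case/dvdpP => q phiq.
have phi0 : mmap polyC h v = 0.
  apply/polyP => i; rewrite coef0; have [lt_ik|le_ki] := ltnP i k.+1.
    by rewrite phiq coefMXn lt_ik.
  (* A coefficient of index above [k] reappears in the derivative of order [k.+1], which is 0, times
     an integer that is nonzero in characteristic 0. *)
  have := congr1 (fun r : {poly K} => r`_(i - k.+1)) (derivn_mmap v k.+1 dh).
  rewrite Dv rmorph0 coef0 coef_derivn subnKC // => /eqP.
  by rewrite mulrn_eq0 -leqn0 leqNgt ffact_gt0 le_ki => /eqP.
transitivity (mmap polyC h v).[1]; last by rewrite phi0 horner0.
rewrite horner_sum mevalE; apply: eq_bigr => m _.
rewrite hornerM hornerC horner_prod; congr (_ * _); apply: eq_bigr => i _.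
rewrite horner_exp hornerM hornerC /g; case: ifP => _.
  by rewrite hornerX mulr1.
by rewrite hornerXsubC subrr mulr0.
Qed.

(** Exponents at most 1 make a monomial the indicator of a set; [v@_(mesym1 S)] is the c_S of the
    overview. *)
Lemma mpoly_multiaffine N v :
  (forall i, (mdegvar i v <= 1)%N) -> v \is N.-homog ->
  v = \sum_(S : {set 'I_n} | #|S| == N) v@_(mesym1 S) *: 'X_[mesym1 S].
Proof.
move=> v1 homv; apply/mpolyP => m; rewrite raddf_sum /=.
have [|no_m] := boolP (mechar N m).
  rewrite mecharP => /existsP [S /andP [/eqP -> cardS]].
  rewrite (bigD1 S) //= mcoeffZ mcoeffX eqxx mulr1 big1 ?addr0 // => T /andP [_ ne].
  rewrite mcoeffZ mcoeffX; case: eqP => [/inj_mesym1 eqTS|_]; last by rewrite mulr0.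
  by rewrite eqTS eqxx in ne.
rewrite big1 => [|S cardS]; last first.
  rewrite mcoeffZ mcoeffX; case: eqP => [eqm|_]; last by rewrite mulr0.
  by case/negP: no_m; rewrite mecharP; apply/existsP; exists S; rewrite eqm eqxx.
apply: contraNeq no_m; rewrite -mcoeff_msupp => mv.
rewrite /mechar -(dhomog_mf homv mv) eqxx /=; apply/forallP => i.
by move/mdegvar_leP: (v1 i); apply; rewrite -mcoeff_msupp.
Qed.

Lemma meval_multiaffine N v u :
  (forall i, (mdegvar i v <= 1)%N) -> v \is N.-homog ->
  v.@[u] = \sum_(S : {set 'I_n} | #|S| == N) v@_(mesym1 S) * \prod_(i in S) u i.
Proof.
move=> v1 homv; rewrite {1}(mpoly_multiaffine v1 homv) raddf_sum.
apply: eq_bigr => S _ /=; rewrite mevalZ mevalX; congr (_ * _).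
rewrite [RHS]big_mkcond; apply: eq_bigr => i _ /=; rewrite mnmE.
by case: (i \in S).
Qed.

Lemma meval_restrict N v u (A : {set 'I_n}) :
  (forall i, (mdegvar i v <= 1)%N) -> v \is N.-homog ->
  v.@[fun i => if i \in A then u i else 0] =
  \sum_(S : {set 'I_n} | (#|S| == N) && (S \subset A))
     v@_(mesym1 S) * \prod_(i in S) u i.
Proof.
move=> v1 homv; rewrite (meval_multiaffine _ v1 homv) [RHS]big_mkcondr /=.
apply: eq_bigr => S _; case: ifPn => [/subsetP sSA|/subsetPn [i iS /negPf niA]].
  by congr (_ * _); apply: eq_bigr => i /sSA ->.
by rewrite (bigD1 i) //= niA mul0r mulr0.
Qed.

Lemma meval_restrict_card N v u (A : {set 'I_n}) :
  (forall i, (mdegvar i v <= 1)%N) -> v \is N.-homog -> #|A| = N ->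
  v.@[fun i => if i \in A then u i else 0] =
  v@_(mesym1 A) * \prod_(i in A) u i.
Proof.
move=> v1 homv cardA; rewrite (meval_restrict _ _ v1 homv) (big_pred1 A) // => S.
apply/andP/eqP => [[/eqP cS sSA]|->]; last by rewrite cardA eqxx.
by apply/eqP; rewrite eqEcard sSA cardA cS leqnn.
Qed.

(** The [N]-subsets of [A] arise by removing one point, which produces the unknowns d_k of the
    Cauchy system. *)
Lemma meval_restrict_cardS N v u (A : {set 'I_n}) :
  (forall i, (mdegvar i v <= 1)%N) -> v \is N.-homog -> #|A| = N.+1 ->
  v.@[fun i => if i \in A then u i else 0] =
  \sum_(k in A) v@_(mesym1 (A :\ k)) * \prod_(i in A :\ k) u i.
Proof.
move=> v1 homv cardA; rewrite (meval_restrict _ _ v1 homv).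
rewrite -(big_imset (h := fun k => A :\ k)
   (fun S : {set _} => v@_(mesym1 S) * \prod_(i in S) u i)) /=; last first.
  move=> k l kA lA /setP /(_ l); rewrite !in_setD1 eqxx lA andbT /=.
  by case: eqVneq.
apply: eq_bigl => S; apply/andP/imsetP => [[/eqP cS sSA]|[k kA ->]]; last first.
  by rewrite subD1set; split=> //; have := cardsD1 k A; rewrite cardA kA => -[->].
have /eqP/cards1P [k eqk] : #|A :\: S| = 1%N.
  by rewrite cardsD (setIidPr sSA) cardA cS subSnn.
have kA : k \in A by have := set11 k; rewrite -eqk inE => /andP [].
exists k => //; apply/eqP; rewrite eqEcard subsetD1 sSA /=; apply/andP; split.
  by have := set11 k; rewrite -eqk inE => /andP [].
by rewrite cS -ltnS -cardA (cardsD1 k A) kA.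
Qed.

End Lines.

(** * Conformal blocks: dimension at most one, and order of vanishing at z *)

Section ConformalBlocks.
Variables (K : numFieldType) (N : nat) (z : 'I_(N + N) -> K).
Hypothesis z_inj : injective z.
Implicit Types (v : {mpoly K[N + N]}).

(** On a monomial of degree d, h acts as 2N - 2d, which in characteristic 0 vanishes only for d =
    N. *)
Lemma opH_eq0_homog v : opH v = 0 -> v \is N.-homog.
Proof.
move=> Hv; apply/dhomogP => m; rewrite mcoeff_msupp => nz.
have := congr1 (mcoeff m) Hv.
rewrite opHE mcoeffB !mcoeffMn mcoeff_euler mcoeff0 -mulrnA => /eqP.
rewrite subr_eq0 => /eqP /(mulrIn nz) /= degm.
by apply/eqP; rewrite -(eqn_pmul2r (isT : 0 < 2)%N) -degm muln2 addnn.
Qed.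

Lemma conformal_block_linear c v w :
  conformal_block z v -> conformal_block z w -> conformal_block z (c *: v + w).
Proof.
move=> [v1 Hv Ev Dv] [w1 Hw Ew Dw]; split.
- by move=> i; apply: mdegvarD; rewrite ?mdegvarZ.
- by rewrite linearP /= Hv Hw scaler0 addr0.
- by rewrite opE_opEz linearP /= -!opE_opEz Ev Ew scaler0 addr0.
- by rewrite !linearP /= Dv Dw scaler0 addr0.
Qed.

Lemma conformal_block0 : conformal_block z 0.
Proof.
split; rewrite ?opE_opEz ?linear0 // => i.
by apply/mdegvar_leP => m; rewrite mcoeff0 eqxx.
Qed.

Lemma opEz_sub_const_block v j :
  conformal_block z v -> opEz (fun a => z a - z j) v = opEz z v.
Proof. by case=> _ _ Ev _; rewrite opEz_sub_const Ev scaler0 subr0. Qed.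

(** Dropping [k0] leaves [N] unknowns, against the sum relation and one equation for each of the
    [N.-1] indices outside [A]: the count that [cauchy_kernel] needs. *)
Lemma conformal_block_swap v (A : {set 'I_(N + N)}) k0 :
  conformal_block z v -> #|A| = N.+1 -> k0 \in A ->
  v@_(mesym1 (A :\ k0)) = 0 -> {in A, forall k, v@_(mesym1 (A :\ k)) = 0}.
Proof.
move=> Wv cardA k0A vk0; have [v1 Hv Ev Dv] := Wv.
have homv := opH_eq0_homog Hv.
have cardC : #|~: A| = N.-1.
  have : (N.+1 + #|~: A| = N + N)%N by rewrite -cardA cardsC card_ord.
  by rewrite addSnnS => /addnI /(congr1 predn).
have N_gt0 : (0 < N)%N.
  have := max_card (mem A); rewrite cardA card_ord lt0n.
  by apply: contraTneq => eqN; rewrite eqN.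
pose d k := v@_(mesym1 (A :\ k)).
have sumE (F : 'I_(N + N) -> K) :
    \sum_(k in A) d k * F k = 0 -> \sum_(k in A :\ k0) d k * F k = 0.
  by rewrite (big_setD1 k0 k0A) /= {1}/d vk0 mul0r add0r.
suff dA : {in A :\ k0, forall k, d k = 0}.
  move=> k kA; have [-> //|ne] := eqVneq k k0.
  by apply: dA; rewrite in_setD1 ne.
apply: (cauchy_kernel (s := [seq z j | j in ~: A])) z_inj _ _ _ _ _.
- by rewrite map_inj_uniq ?enum_uniq.
- move=> k; rewrite in_setD1 => /andP [_ kA]; apply/negP => /mapP [j].
  by rewrite mem_enum inE => /negP jA /z_inj ejk; apply: jA; rewrite -ejk.
- rewrite size_map -cardE cardC prednK //.
  by have := cardsD1 k0 A; rewrite cardA k0A add1n => -[<-].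
- have /sumE : \sum_(k in A) d k * 1 = 0.
    transitivity (v.@[fun i => if i \in A then 1 else 0]).
      rewrite (meval_restrict_cardS _ v1 homv cardA).
      by apply: eq_bigr => k kA; rewrite big1.
    (* In the direction with all entries 1 the operator is [opE], which kills [v]. *)
    apply: (meval_restrict_eq0 (k := 0) v1 homv); first by rewrite /= -opE_opEz.
    by rewrite cardC addn0 prednK.
  by under eq_bigr do rewrite mulr1.
move=> _ /mapP [j + ->]; rewrite mem_enum inE => jA; apply: sumE.
pose w i := z i - z j.
have nzw i : i \in A -> w i != 0.
  by move=> iA; rewrite subr_eq0 (inj_eq z_inj); apply: contraNneq jA => <-.
have : v.@[fun i => if i \in A then w i else 0] = 0.
  (* As [w j = 0], adding [j] to [A] does not move the point, but it shrinks the complement to N - 2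
     elements, as [k := 1] requires. *)
  transitivity (v.@[fun i => if i \in j |: A then w i else 0]).
    apply: meval_eq => i; rewrite in_setU1; case: eqP => //= ->.
    by rewrite (negPf jA) /w subrr.
  apply: (meval_restrict_eq0 (k := 1) v1 homv).
  - rewrite /= (opEz_sub_const_block _ Wv) opEz_sub_const Dv.
    by rewrite !opE_opEz opEz_comm -opE_opEz Ev linear0 scaler0 subr0.
  - have := cardsC (j |: A); rewrite cardsU1 jA cardA card_ord add1n !addSnnS.
    by move/addnI => eqN; rewrite addn1 (eq_leq eqN).
rewrite (meval_restrict_cardS _ v1 homv cardA) => sumw.
(* Dividing by the product over all of [A] turns each product over [A :\ k] into [(w k)^-1]. *)
transitivity ((\prod_(i in A) w i)^-1 *
  \sum_(k in A) d k * \prod_(i in A :\ k) w i); last by rewrite sumw mulr0.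
rewrite mulr_sumr; apply: eq_bigr => k kA; rewrite mulrCA; congr (_ * _).
rewrite (big_setD1 k kA) /= invfM -mulrA mulVf ?mulr1 //.
by apply/prodf_neq0 => i; rewrite in_setD1 => /andP [_ /nzw].
Qed.

(** One coefficient determines a block, so W(z) has dimension at most 1. Induction on [#|S :\: S0|]:
    inside [l |: S], removing [i] gives a set closer to [S0], while removing [l] gives [S] back. *)
Lemma conformal_block_coef_inj v (S0 : {set 'I_(N + N)}) :
  conformal_block z v -> #|S0| = N -> v@_(mesym1 S0) = 0 -> v = 0.
Proof.
move=> Wv cardS0 vS0; have [v1 Hv _ _] := Wv.
rewrite (mpoly_multiaffine v1 (opH_eq0_homog Hv)) big1 // => S /eqP cardS.
suff -> : v@_(mesym1 S) = 0 by rewrite scale0r.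
have [k] := ubnP #|S :\: S0|; elim: k S cardS => // k IH S cardS ltk.
have [sSS0|/subsetPn [i iS iNS0]] := boolP (S \subset S0).
  by have /eqP -> : S == S0 by rewrite eqEcard sSS0 cardS cardS0 leqnn.
have [sS0S|/subsetPn [l lS0 lNS]] := boolP (S0 \subset S).
  by have /eqP <- : S0 == S by rewrite eqEcard sS0S cardS cardS0 leqnn.
have ne_il : i != l by apply: contraNneq iNS0 => ->.
have cardA : #|l |: S| = N.+1 by rewrite cardsU1 lNS cardS.
have iA : i \in l |: S by rewrite in_setU1 iS orbT.
have SE : (l |: S) :\ l = S by rewrite setU1K.
rewrite -[in LHS]SE; apply: (conformal_block_swap Wv cardA iA); last exact: setU11.
apply: IH.
  by have := cardsD1 i (l |: S); rewrite cardA iA add1n => -[<-].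
apply: leq_trans (_ : #|S :\: S0| <= k)%N; last by rewrite -ltnS.
apply: proper_card; apply/properP; split.
  apply/subsetP => a; rewrite !inE => /and3P [aNS0 _ /orP [/eqP ea|->]].
    by rewrite ea lS0 in aNS0.
  by rewrite aNS0.
by exists i; rewrite !inE ?iS ?iNS0 // eqxx.
Qed.

(** If D_z v were 0, the restriction lemma would apply with [k := 0], allowing N - 1 indices outside
    [j |: S]. The value at z - z_j restricted to [S] is c_S times nonzero differences, so c_S would
    vanish. *)
Lemma opEz_block_neq0 v : (0 < N)%N ->
  conformal_block z v -> v != 0 -> opEz z v != 0.
Proof.
move=> N_gt0 Wv; apply: contra_neq => Dv.
have [v1 Hv Ev _] := Wv; have homv := opH_eq0_homog Hv.
pose S := [set lshift N a | a : 'I_N].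
have cardS : #|S| = N by rewrite card_imset ?card_ord //; apply: lshift_inj.
apply: (conformal_block_coef_inj Wv cardS).
pose j := rshift N (Ordinal N_gt0).
have jS : j \notin S by apply/imsetP => -[a _ /eqP]; rewrite eq_rlshift.
pose w i := z i - z j.
have : v.@[fun i => if i \in S then w i else 0] = 0.
  transitivity (v.@[fun i => if i \in j |: S then w i else 0]).
    apply: meval_eq => i; rewrite in_setU1; case: eqP => //= ->.
    by rewrite (negPf jS) /w subrr.
  apply: (meval_restrict_eq0 (k := 0) v1 homv).
  - by rewrite /= (opEz_sub_const_block _ Wv).
  - have := cardsC (j |: S); rewrite cardsU1 jS cardS card_ord add1n !addSnnS.
    by move/addnI => eqN; rewrite addn0 (eq_leq eqN).
rewrite (meval_restrict_card _ v1 homv cardS) => /eqP; rewrite mulf_eq0.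
case/orP => [/eqP //|]; rewrite prodf_seq_eq0 => /hasP [i _ /andP [iS]].
by rewrite subr_eq0 (inj_eq z_inj) => /eqP eij; rewrite -eij iS in jS.
Qed.

Lemma generator_block v :
  conformal_block z v -> v != 0 -> generator (conformal_block z) v.
Proof.
move=> Wv nzv; split; first exact/eqP.
pose S := [set lshift N a | a : 'I_N].
have cardS : #|S| = N by rewrite card_imset ?card_ord //; apply: lshift_inj.
have nzvS : v@_(mesym1 S) != 0.
  by apply: contra_neq nzv; apply: conformal_block_coef_inj.
move=> w; split=> [Ww|[c ->]]; last first.
  rewrite -[c *: v]addr0; apply: conformal_block_linear => //.
  exact: conformal_block0.
(* This scalar cancels the coefficient at [S] of the difference. *)
exists (w@_(mesym1 S) / v@_(mesym1 S)).
apply/eqP; rewrite -subr_eq0 addrC -scaleNr; apply/eqP.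
apply: (conformal_block_coef_inj _ cardS); first exact: conformal_block_linear.
by rewrite mcoeffD mcoeffZ mulNr divfK // addNr.
Qed.

Lemma meval_dhomog0 n (p : {mpoly K[n]}) x : p \is 0.-homog -> p.@[x] = p@_0%MM.
Proof.
move=> homp; suff {1}-> : p = (p@_0%MM)%:MP by rewrite mevalC.
apply/mpolyP => m; rewrite mcoeffC; have [->|ne] := eqVneq m 0%MM.
  by rewrite mulr1.
by rewrite (dhomog_nemf_coeff homp) ?mulr0 //= mdeg_eq0.
Qed.

(* For [q] homogeneous of degree [d], Euler's identity gives
   [(D_z q)(z) = d q(z)]; it is applied to the derivatives of [v]. *)
Lemma vanishing_order_block v : (0 < N)%N ->
  conformal_block z v -> v != 0 -> vanishing_order v z N.-1.
Proof.
move=> N_gt0 Wv nzv; have [v1 Hv Ev D2v] := Wv.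
have homv := opH_eq0_homog Hv; split=> [m ltm|].
  have homq := dhomog_mderivm m homv.
  (* With d = N - [mdeg m] and q the derivative, Euler applied twice gives d (d - 1) q(z) = (D_z^2
     q)(z) = 0, and here d > 1. *)
  have := meval_opEz_homog z (dhomog_opEz z homq).
  rewrite (meval_opEz_homog z homq) !opEz_mderivm D2v linear0 meval0.
  move/esym/eqP; rewrite -mulrnA mulrn_eq0 muln_eq0.
  suff /negPf -> : ~~ ((N - mdeg m == 0) || ((N - mdeg m).-1 == 0))%N by move/eqP.
  rewrite -subn1 !subn_eq0 negb_or -!ltnNge ltn_subRL addn1.
  move: ltm; rewrite -subn1 ltn_subRL add1n => ltm.
  by rewrite ltm ltnW // ltnW.
have nzD := opEz_block_neq0 N_gt0 Wv nzv.
have homD := dhomog_opEz z homv.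
(* For a monomial [m] of D_z v, the derivative of [v] along [m] has degree 1, so its value at z is
   the derivative of D_z v along [m]: a constant, equal to a nonzero coefficient times
   factorials. *)
have mD := mlead_supp nzD; set m := mlead _ in mD.
have degm : mdeg m = N.-1 := dhomog_mf homD mD.
exists m => //; have homq := dhomog_mderivm m homv.
have := meval_opEz_homog z homq.
rewrite degm -subn1 subKn // mulr1n => <-; rewrite opEz_mderivm.
have := dhomog_mderivm m homD; rewrite degm subnn => /meval_dhomog0 ->.
rewrite mcoeff_mderivm addm0; apply/eqP.
rewrite mulrn_eq0 negb_or -mcoeff_msupp mD andbT.
by rewrite -lt0n prodn_gt0 // => i; rewrite ffactnn fact_gt0.
Qed.

End ConformalBlocks.

(** * The determinant P: invariance, degrees, D_z^2 P = 0 and P nonzero *)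

Lemma det_sub_row0 (R : comNzRingType) n (A : 'M[R]_n.+1) :
  \det (\matrix_(i, j) (A i j - (i != ord0)%:R * A ord0 j)) = \det A.
Proof.
(* [L] performs the row operation from the left: it is lower triangular with unit diagonal, with -1
   below the diagonal in the first column. *)
pose L : 'M[R]_n.+1 :=
  \matrix_(i, j) ((i == j)%:R - ((i != ord0) && (j == ord0))%:R).
have detL : \det L = 1.
  rewrite det_trig; last first.
    apply/is_trig_mxP => i j lt_ij; rewrite mxE.
    have ne0 : j != ord0 by rewrite -val_eqE /= -lt0n (leq_ltn_trans _ lt_ij).
    by rewrite (negPf ne0) andbF -val_eqE /= ltn_eqF // subrr.
  rewrite big1 // => i _; rewrite mxE eqxx andNb.
  by rewrite subr0.
transitivity (\det L * \det A); last by rewrite detL mul1r.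
rewrite -det_mulmx; congr (\det _).
apply/matrixP => i j; rewrite !mxE.
have -> : A i j = \sum_k (i == k)%:R * A k j.
  rewrite (bigD1 i) //= eqxx mul1r big1 ?addr0 // => k ne.
  by rewrite eq_sym (negPf ne) mul0r.
have -> : (i != ord0)%:R * A ord0 j = \sum_k ((i != ord0) && (k == ord0))%:R * A k j.
  rewrite (bigD1 ord0) //= andbT big1 ?addr0 // => k ne.
  by rewrite (negPf ne) andbF mul0r.
by rewrite -sumrB; apply: eq_bigr => k _; rewrite !mxE mulrBl.
Qed.

Section DetP.
Variables (K : fieldType) (N : nat) (z : 'I_(N + N) -> K).

Lemma detP_expand :
  detP z = \sum_(s : 'S_N) (-1) ^+ s * \prod_(a < N) entryP z (s a) a.
Proof.
rewrite /detP -det_tr; apply: eq_bigr => s _; congr (_ * _).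
by apply: eq_bigr => a _; rewrite !mxE.
Qed.

Lemma entryP_homog a b : entryP z a b \is 1.-homog.
Proof. by apply: dhomogZ; apply: rpredB; rewrite dhomogX /= mdeg1. Qed.

(** Properties stable under linear combinations need checking only on one product of the
    expansion. *)
Lemma detP_ind (F : {mpoly K[N + N]} -> Prop) :
  (forall p q, F p -> F q -> F (p + q)) -> (forall c p, F p -> F (c *: p)) ->
  F 0 -> (forall s : 'S_N, F (\prod_(a < N) entryP z (s a) a)) -> F (detP z).
Proof.
move=> FD FZ F0 Fprod; rewrite detP_expand; apply: (big_ind F) => // s _.
have -> : (-1) ^+ s = ((-1) ^+ s)%:MP :> {mpoly K[N + N]}.
  by rewrite rmorph_sign.
by rewrite mul_mpolyC; apply/FZ/Fprod.
Qed.

Lemma detP_homog : detP z \is N.-homog.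
Proof.
apply: (detP_ind (F := fun p => p \is N.-homog)) => [p q|c p||s]; first exact: rpredD.
- exact: dhomogZ.
- exact: dhomog0.
rewrite -[X in _ \is X.-homog]card_ord; apply: dhomog_prod_const => a.
exact: entryP_homog.
Qed.

(** In a product of the expansion each variable occurs in only one factor: the two families of
    indices are injective with disjoint ranges. *)
Lemma detP_mdegvar i : (mdegvar i (detP z) <= 1)%N.
Proof.
apply: (detP_ind (F := fun p => (mdegvar i p <= 1)%N)) => [p q|c p||s].
- exact: mdegvarD.
- exact: mdegvarZ.
- by apply/mdegvar_leP => m; rewrite mcoeff0 eqxx.
pose d a : nat := ((lshift N (s a) == i) + (rshift N a == i))%N.
have led a : (mdegvar i (entryP z (s a) a) <= d a)%N.
  apply: mdegvarZ; rewrite -scaleN1r /d; apply: mdegvarD.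
    by apply: leq_trans (mdegvarX _ _ _) _; rewrite leq_addr.
  by apply: mdegvarZ; apply: leq_trans (mdegvarX _ _ _) _; rewrite leq_addl.
apply: leq_trans (mdegvar_prod led) _; rewrite /d big_split /=.
have le1 (f : 'I_N -> 'I_(N + N)) : injective f ->
    (\sum_a (f a == i) <= [exists a, f a == i])%N.
  move=> f_inj; case: existsP => [[a0 /eqP fa0]|no_a]; last first.
    by rewrite big1 // => a _; case: eqP => // fa; case: no_a; exists a; apply/eqP.
  rewrite (bigD1 a0) //= big1 ?addn0 ?leq_b1 // => a ne.
  by rewrite -fa0 (inj_eq f_inj) (negPf ne).
have lel := le1 _ (inj_comp (@lshift_inj N N) (@perm_inj _ s)).
have ler := le1 _ (@rshift_inj N N).
apply: leq_trans (leq_add lel ler) _.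
case: existsP => [[a /eqP ia]|_]; last by rewrite add0n leq_b1.
case: existsP => [[b /eqP ib]|//].
by have := eq_lrshift (s a) b; rewrite -[lshift N _]/((lshift N \o s) a) ia ib eqxx.
Qed.

Lemma detP_opE : opE (detP z) = 0.
Proof.
apply: (detP_ind (F := fun p => opE p = 0)) => [p q|c p||s].
- by rewrite !opE_opEz linearD /= => -> ->; rewrite addr0.
- by rewrite !opE_opEz linearZ /= => ->; rewrite scaler0.
- by rewrite opE_opEz linear0.
rewrite opE_opEz opEzE (vfield_prod (G := fun=> 0)) => [|a].
  by rewrite big1 ?mul0r.
by rewrite mul0r linearZ linearB /= !vfieldXU subrr scaler0.
Qed.

(** The quadratic field multiplies a difference of two variables by their sum; over a product these
    sums add up to the sum of all variables, which cancels the multiplication term of f. *)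
Lemma detP_opF : opF (detP z) = 0.
Proof.
apply: (detP_ind (F := fun p => opF p = 0)) => [p q|c p||s].
- rewrite !opFE mulrDr linearD /= opprD addrACA => -> ->; exact: addr0.
- by rewrite !opFE linearZ /= -scalerAr -scalerBr => ->; rewrite scaler0.
- by rewrite opFE linear0 mulr0 subr0.
pose G a : {mpoly K[N + N]} := 'X_(lshift N (s a)) + 'X_(rshift N a).
rewrite opFE (vfield_prod (G := G)) => [|a]; last first.
  rewrite linearZ linearB /= !vfieldXU /entryP /G -scalerAr subr_sqr; congr (_ *: _).
  exact: mulrC.
rewrite /G big_split /= big_split_ord /=.
rewrite (reindex_inj (@perm_inj _ s)) /=; exact: subrr.
Qed.

Lemma detP_opH : opH (detP z) = 0.
Proof.
by rewrite opHE (euler_homog detP_homog) mulrnDr mulr2n subrr.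
Qed.

End DetP.

(* Subtracting the first row from the others leaves entries killed by [D_z]
   except in the first row, on which [D_z] is [1]: [D_z] acts at most once. *)
Lemma detP_opEz2 (K : fieldType) (N : nat) (z : 'I_(N + N) -> K) :
  injective z -> opEz z (opEz z (detP z)) = 0.
Proof.
case: N z => [|N] z z_inj.
  by rewrite /detP det_mx00 !opEzE vfield1 linear0.
have Dentry a b : opEz z (entryP z a b) = 1.
  rewrite opEzE linearZ linearB /= !vfieldXU -rmorphB /= -mul_mpolyC -rmorphM.
  by rewrite mulVf ?rmorph1 // subr_eq0 (inj_eq z_inj) eq_lrshift.
rewrite /detP -det_sub_row0 (expand_det_row _ ord0) !opEzE.
set A := \matrix_(i, j) _.
have DA i j : vfield (fun a => (z a)%:MP) (A i j) = (i == ord0)%:R.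
  rewrite -opEzE !mxE linearB /= Dentry; case: eqP => _.
    by rewrite mul0r linear0 subr0.
  by rewrite mul1r Dentry subrr.
have Dcof j : vfield (fun a => (z a)%:MP) (cofactor A ord0 j) = 0.
  have Dminor : vfield (fun a => (z a)%:MP) (\det (row' ord0 (col' j A))) = 0.
    by apply: vfield_det0 => k l; rewrite 2!mxE DA.
  rewrite /cofactor -signr_odd; case: odd => /=.
    by rewrite expr1 mulN1r linearN /= Dminor oppr0.
  by rewrite expr0 mul1r.
(* D_z P is the sum of the cofactors of row 0, each killed by D_z. *)
transitivity (vfield (fun a => (z a)%:MP) (\sum_j cofactor A ord0 j)).
  congr vfield; rewrite vfield_sum; apply: eq_bigr => j _.
  by rewrite vfieldM DA Dcof mulr0 addr0 mul1r.
by rewrite vfield_sum big1.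
Qed.

(* At the point [z] shifted by [1] in all but one of the first [N] variables,
   the matrix has entries [1 + 1 / (z_a - z_(N+b))], and [1] in one row. *)
Lemma detP_neq0 (K : fieldType) (N : nat) (z : 'I_(N + N) -> K) :
  injective z -> detP z != 0.
Proof.
case: N z => [|N] z z_inj; first by rewrite /detP det_mx00 oner_neq0.
pose y i := z i + (match split i with inl a => a != 0 | inr _ => false end)%:R.
have yl a : y (lshift _ a) = z (lshift _ a) + (a != 0)%:R.
  by rewrite /y (unsplitK (inl a)).
have yr b : y (rshift _ b) = z (rshift _ b).
  by rewrite /y (unsplitK (inr b)) addr0.
suff : (detP z).@[y] != 0 by apply: contraNneq => ->; rewrite meval0.
(* A zero determinant gives a dependency [v] among the columns. Row 0 says that its entries sum to
   0; subtracting this from the other rows leaves Cauchy equations with poles z_a, [a != 0]. *)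
rewrite -det_map_mx -det_tr; apply/det0P => -[v nzv vA].
pose w b := z (rshift N.+1 b).
have nz a b : z (lshift _ a) - w b != 0.
  by rewrite subr_eq0 (inj_eq z_inj) eq_lrshift.
have sumA a : \sum_b v 0 b * (1 + (a != 0)%:R / (z (lshift _ a) - w b)) = 0.
  have := congr1 (fun M : 'rV_N.+1 => M 0 a) vA; rewrite !mxE => vAa.
  apply: etrans vAa; apply: eq_bigr => b _.
  rewrite !mxE /= mevalZ mevalB !mevalXU yl yr; congr (_ * _).
  by rewrite addrAC mulrDr mulVf ?nz //; congr (_ + _); apply: mulrC.
have sum0 : \sum_b v 0 b = 0.
  apply: etrans (sumA 0); apply: eq_bigr => b _.
  by rewrite eqxx mul0r addr0 mulr1.
suff v0 : {in [set: 'I_N.+1], forall b, v 0 b = 0}.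
  by case/eqP: nzv; apply/rowP => b; rewrite v0 ?inE // mxE.
apply: (cauchy_kernel (z := w) (s := [seq z (lshift N.+1 a) | a in predC1 0])).
- by move=> b c /z_inj /rshift_inj.
- by rewrite map_inj_uniq ?enum_uniq // => a b /z_inj /lshift_inj.
- move=> b _; apply/negP => /mapP [a _ /z_inj /eqP].
  by rewrite eq_rlshift.
- by rewrite cardsT size_map -cardE cardC1 card_ord.
- by rewrite -[RHS]sum0; apply: eq_bigl => b; rewrite inE.
move=> _ /mapP [a + ->]; rewrite mem_enum => /negPf ne_a0.
transitivity (\sum_b v 0 b - \sum_b v 0 b * (1 + (a != 0)%:R / (z (lshift _ a) - w b))).
  rewrite -sumrB; apply: eq_big => [b|b _]; first by rewrite inE.
  rewrite ne_a0 mulrDr mulr1 opprD addrA subrr add0r mul1r -mulrN -invrN.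
  by rewrite opprB.
by rewrite sumA sum0 subrr.
Qed.

Theorem theorem3p2 (R : realType) (N : nat) (z : 'I_(N + N) -> R[i])
    (N_gt0 : (0 < N)%N) (z_inj : injective z) :
  detP z = \sum_(s : 'S_N) (-1) ^+ s * \prod_(a < N) entryP z (s a) a /\
  [/\ sl2_invariant (detP z),
      detP z \is N.-homog,
      (forall i : 'I_(N + N), (mdegvar i (detP z) <= 1)%N),
      vanishing_order (detP z) z N.-1
    & generator (conformal_block z) (detP z)].
Proof.
have WP : conformal_block z (detP z).
  split; [exact: detP_mdegvar|exact: detP_opH|exact: detP_opE|].
  exact: detP_opEz2.
have nzP := detP_neq0 z_inj.
split; first exact: detP_expand.
split.
- split; [exact: detP_opE|exact: detP_opF|exact: detP_opH].
- exact: detP_homog.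
- exact: detP_mdegvar.
- exact: vanishing_order_block.
exact: generator_block.
Qed.
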